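(* Let $\mathfrak{E}=\{x+y\omega\mid x,y\in\mathbb{Z}\}$ with $\omega=-\frac12+\frac{\sqrt3}{2}i$ and $K=\mathbb{Q}(\omega)$. Let $f:\mathbb{C}\to\mathfrak{E}$ be the nearest integer algorithm, i.e. $f(\zeta)$ is an element of $\mathfrak{E}$ nearest to $\zeta$ (ties broken by some fixed convention). Let $z\notin K$, define $z_0=z$, $z_{n+1}=(z_n-f(z_n))^{-1}$, $a_n=f(z_n)$ for $n\ge0$, and let $\{p_n\},\{q_n\}$ be the $\mathcal{Q}$-pair of $\{a_n\}$. Then $\left|\frac{q_{n+1}}{q_{n-1}}\right|>\frac32$ for all $n\geq1$.
   Context: The $\mathcal{Q}$-pair of $\{a_n\}_{n\ge0}$: $p_{-1}=1$, $p_0=a_0$, $p_{n+1}=a_{n+1}p_n+p_{n-1}$, $q_{-1}=0$, $q_0=1$, $q_{n+1}=a_{n+1}q_n+q_{n-1}$ ($n\ge0$). *)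

(* Defs.v *)
From Stdlib Require Import Reals ZArith.
From Coquelicot Require Import Coquelicot.
Open Scope C_scope.

Definition omega : C := (- (1 / 2), sqrt 3 / 2)%R.

Definition Eisenstein (u : C) : Prop :=
  exists x y : Z, u = RtoC (IZR x) + RtoC (IZR y) * omega.

Record is_subfield (S : C -> Prop) : Prop := {
  subfield_one : S 1;
  subfield_sub : forall u v, S u -> S v -> S (u - v);
  subfield_mul : forall u v, S u -> S v -> S (u * v);
  subfield_inv : forall u, S u -> u <> 0 -> S (/ u)
}.

(* The field Q(w), as the smallest subfield of C containing w; every subfield
   of C contains Q. *)
Definition Q_adjoin (w z : C) : Prop :=
  forall S : C -> Prop, is_subfield S -> S w -> S z.

(* Ties are resolved by the choice of the function f itself. *)
Definition nearest_integer_algorithm (f : C -> C) : Prop :=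
  forall zeta : C,
    Eisenstein (f zeta) /\
    forall u : C, Eisenstein u -> (Cmod (zeta - f zeta) <= Cmod (zeta - u))%R.

Fixpoint iter_z (f : C -> C) (z : C) (n : nat) : C :=
  match n with
  | O => z
  | S m => / (iter_z f z m - f (iter_z f z m))
  end.

Definition partial_quot (f : C -> C) (z : C) (n : nat) : C := f (iter_z f z n).

(* The pair (x_{n-1}, x_n), where x_{-1} = u, x_0 = v and
   x_{n+1} = a_{n+1} x_n + x_{n-1}. *)
Fixpoint Q_rec (a : nat -> C) (u v : C) (n : nat) : C * C :=
  match n with
  | O => (u, v)
  | S m => let (x, y) := Q_rec a u v m in (y, a (S m) * y + x)
  end.

(* The Q-pair (p_n), (q_n) for n >= 0. *)
Definition Q_pair_p (a : nat -> C) (n : nat) : C := snd (Q_rec a 1 (a O) n).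
Definition Q_pair_q (a : nat -> C) (n : nat) : C := snd (Q_rec a 0 1 n).

(* Main.v *)
Require Import Defs.
From Stdlib Require Import Reals ZArith Lra Lia Psatz.
From Coquelicot Require Import Coquelicot.
Open Scope C_scope.

(** The remainders [d = z_n - a_n] lie in the hexagonal Voronoi cell of [0], so
    [z_(n+1) = / d] stays at distance at least 1 from the six units. Hence
    [|a_n|^2 >= 3] for [n >= 1], and if [a_n - t] and [t] are both units then
    [Re (t a_(n+1)) >= -1]. For consecutive digits [a], [b] of norm 3 or 4 this
    leaves only pairs with [|a b + 1| >= |b| + 3 / 2]. As [|q_n|] increases,
    [q_(n+1) = (a b + 1) q_(n-1) + b q_(n-2)] gives the bound for such pairs; when
    one of the norms is at least 7, [q_(n+1) = b q_n + q_(n-1)] is enough. *)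

(** * Norm and trace of Eisenstein integers in integer coordinates *)

Definition eis (x y : Z) : C := RtoC (IZR x) + RtoC (IZR y) * omega.
Definition eis_norm (x y : Z) : Z := (x * x - x * y + y * y)%Z.
(* The trace [2 Re] of the product of [eis x y] and [eis x' y']. *)
Definition eis_trace_mul (x y x' y' : Z) : Z :=
  (2 * x * x' - y * y' - x * y' - x' * y)%Z.

(** From 4 N = (2y - x)^2 + 3x^2 and its mirror image; it makes small norms a finite check. *)
Lemma eis_norm_bound (x y : Z) :
  (eis_norm x y <= 6 -> -2 <= x <= 2 /\ -2 <= y <= 2)%Z.
Proof.
  unfold eis_norm; intros H.
  assert (Hx : (x * x <= 8)%Z) by (pose proof (Z.square_nonneg (2 * y - x)); nia).
  assert (Hy : (y * y <= 8)%Z) by (pose proof (Z.square_nonneg (2 * x - y)); nia).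
  repeat split; nia.
Qed.

Ltac eis_enum x :=
  let H := fresh in
  assert (H : (x = -2 \/ x = -1 \/ x = 0 \/ x = 1 \/ x = 2)%Z) by lia;
  destruct H as [-> | [-> | [-> | [-> | ->]]]].

(** The form x^2 - xy + y^2 represents neither 5 nor 6. *)
Lemma eis_norm_gap (x y : Z) :
  (3 <= eis_norm x y)%Z ->
  (eis_norm x y = 3 \/ eis_norm x y = 4 \/ 7 <= eis_norm x y)%Z.
Proof.
  intros H.
  destruct (Z_le_gt_dec (eis_norm x y) 6) as [H6|H6]; [|lia].
  destruct (eis_norm_bound x y H6) as [Hx Hy].
  revert H H6; eis_enum x; eis_enum y; cbn; lia.
Qed.

(** The right side is |ab + 1|^2, so this says |ab + 1|^2 >= |b|^2 + 9. It is a finite check over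
    the digits of norm 3 and 4. *)
Lemma eis_mul_add1_norm_ge (x y x' y' : Z) :
  (eis_norm x y = 3 \/ eis_norm x y = 4)%Z ->
  (eis_norm x' y' = 3 \/ eis_norm x' y' = 4)%Z ->
  (forall s t : Z, eis_norm s t = 1 -> eis_norm (x - s) (y - t) = 1 ->
     -2 <= eis_trace_mul s t x' y')%Z ->
  (eis_norm x' y' + 9 <=
   eis_norm x y * eis_norm x' y' + eis_trace_mul x y x' y' + 1)%Z.
Proof.
  intros Ha Hb H.
  destruct (eis_norm_bound x y) as [Hx Hy]; [lia|].
  destruct (eis_norm_bound x' y') as [Hx' Hy']; [lia|].
  revert Ha Hb.
  eis_enum x; eis_enum y; cbn; try (intros; exfalso; lia);
    intros _;
    (* The six units are the only possible values of [s], [t]. *)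
    pose proof (H 1 0)%Z as H1; pose proof (H (-1) 0)%Z as H2;
    pose proof (H 0 1)%Z as H3; pose proof (H 0 (-1))%Z as H4;
    pose proof (H 1 1)%Z as H5; pose proof (H (-1) (-1))%Z as H6;
    clear H;
    eis_enum x'; eis_enum y'; cbn in *; try (intros; exfalso; lia);
    intros _; lia.
Qed.

(** * From integer coordinates to complex numbers *)

Lemma Re_eis (x y : Z) : Re (eis x y) = (IZR x - IZR y / 2)%R.
Proof. unfold eis, omega; cbn; field. Qed.

Lemma Im_eis (x y : Z) : Im (eis x y) = (IZR y * (sqrt 3 / 2))%R.
Proof. unfold eis, omega; cbn; field. Qed.

Lemma sqrt3_sqr : (sqrt 3 * sqrt 3 = 3)%R.
Proof. apply sqrt_sqrt; lra. Qed.

Lemma Cmod_eis_sqr (x y : Z) : (Cmod (eis x y) ^ 2 = IZR (eis_norm x y))%R.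
Proof.
  rewrite Cmod2_alt, Re_eis, Im_eis; unfold eis_norm.
  rewrite plus_IZR, minus_IZR, !mult_IZR.
  replace ((IZR y * (sqrt 3 / 2)) ^ 2)%R
    with (IZR y * IZR y * (sqrt 3 * sqrt 3) / 4)%R by field.
  rewrite sqrt3_sqr; field.
Qed.

Lemma Cmod_eis_unit (x y : Z) : eis_norm x y = 1%Z -> Cmod (eis x y) = 1%R.
Proof.
  intros H; pose proof (Cmod_eis_sqr x y) as E; rewrite H in E.
  pose proof (Cmod_ge_0 (eis x y)); nra.
Qed.

Lemma Re_eis_mul (x y x' y' : Z) :
  Re (eis x y * eis x' y') = (IZR (eis_trace_mul x y x' y') / 2)%R.
Proof.
  rewrite re_mult, !Re_eis, !Im_eis; unfold eis_trace_mul.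
  rewrite !minus_IZR, !mult_IZR.
  replace (IZR y * (sqrt 3 / 2) * (IZR y' * (sqrt 3 / 2)))%R
    with (IZR y * IZR y' * (sqrt 3 * sqrt 3) / 4)%R by field.
  rewrite sqrt3_sqr; field.
Qed.

Lemma Cmod_eis_mul_add1_sqr (x y x' y' : Z) :
  (Cmod (eis x y * eis x' y' + 1) ^ 2 =
   IZR (eis_norm x y * eis_norm x' y' + eis_trace_mul x y x' y' + 1))%R.
Proof.
  rewrite !plus_IZR, mult_IZR, <- !Cmod_eis_sqr.
  assert (E := Re_eis_mul x y x' y').
  assert (M : (Cmod (eis x y * eis x' y') ^ 2 =
               Cmod (eis x y) ^ 2 * Cmod (eis x' y') ^ 2)%R)
    by (rewrite Cmod_mult; ring).
  rewrite <- M, !Cmod2_alt, re_plus, im_plus, re_RtoC, im_RtoC, E; field.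
Qed.

Lemma Eisenstein_eis (x y : Z) : Eisenstein (eis x y).
Proof. now exists x, y. Qed.

Lemma Eisenstein_add (u v : C) :
  Eisenstein u -> Eisenstein v -> Eisenstein (u + v).
Proof.
  intros [x [y ->]] [x' [y' ->]]; exists (x + x')%Z, (y + y')%Z.
  rewrite !plus_IZR, !RtoC_plus; ring.
Qed.

Lemma Cconj_eis (x y : Z) : Cconj (eis x y) = eis (x - y) (- y).
Proof.
  unfold eis, omega; rewrite minus_IZR, opp_IZR.
  apply injective_projections; cbn; field.
Qed.

Lemma eis_sub (x y s t : Z) : eis (x - s) (y - t) = eis x y - eis s t.
Proof. unfold eis; rewrite !minus_IZR, !RtoC_minus; ring. Qed.

(** * The hexagonal cell and its image under inversion *)

(** For a unit t, Re (t d) <= 1/2 means that d is no nearer to conj t than to 0; conj t runs over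
    all units as t does. *)
Definition hexagon (d : C) : Prop :=
  forall s t : Z, eis_norm s t = 1%Z -> (Re (eis s t * d) <= 1 / 2)%R.

(** Comparison with the neighbour [f zeta] + conj t: |d|^2 <= |d - conj t|^2 = |d|^2 - 2 Re (t d) +
    1. *)
Lemma nearest_hexagon (f : C -> C) (zeta : C) :
  nearest_integer_algorithm f -> hexagon (zeta - f zeta).
Proof.
  intros Hf s t H; destruct (Hf zeta) as [HE Hmin].
  specialize (Hmin (f zeta + Cconj (eis s t))).
  rewrite Cconj_eis in Hmin.
  specialize (Hmin (Eisenstein_add _ _ HE (Eisenstein_eis _ _))).
  rewrite <- Cconj_eis in Hmin.
  replace (zeta - (f zeta + Cconj (eis s t)))
    with ((zeta - f zeta) - Cconj (eis s t)) in Hmin by ring.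
  set (d := zeta - f zeta) in *; clearbody d.
  pose proof (Cmod_eis_sqr s t) as HN; rewrite H, Cmod2_alt in HN.
  apply (fun H => pow_incr _ _ 2 (conj (Cmod_ge_0 _) H)) in Hmin.
  rewrite !Cmod2_alt in Hmin; unfold Cminus in Hmin.
  rewrite re_plus, im_plus, re_opp, im_opp, re_conj, im_conj in Hmin.
  rewrite re_mult; nra.
Qed.

Lemma hexagon_Cmod_lt1 (d : C) : hexagon d -> (Cmod d < 1)%R.
Proof.
  intros H.
  pose proof (H 1 0 eq_refl)%Z as H1; pose proof (H (-1) 0 eq_refl)%Z as H2.
  pose proof (H 0 1 eq_refl)%Z as H3; pose proof (H 0 (-1) eq_refl)%Z as H4.
  pose proof (H 1 1 eq_refl)%Z as H5; pose proof (H (-1) (-1) eq_refl)%Z as H6.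
  rewrite re_mult, Re_eis, Im_eis in H1, H2, H3, H4, H5, H6.
  pose proof (Cmod2_alt d) as E; pose proof (Cmod_ge_0 d).
  set (p := Re d) in *; set (q := Im d) in *; clearbody p q.
  (* The units 1, -1 bound [p]; adding the other constraints in pairs bounds [q]. Then |d|^2 <= 1/4
     + 1/3. *)
  assert (Hp : (p ^ 2 <= 1 / 4)%R) by nra.
  assert (Hq : ((sqrt 3 * q) ^ 2 <= 1)%R) by nra.
  replace ((sqrt 3 * q) ^ 2)%R with (sqrt 3 * sqrt 3 * q ^ 2)%R in Hq by ring.
  rewrite sqrt3_sqr in Hq.
  nra.
Qed.

(** Inversion sends the half-plane Re (t d) <= 1/2 outside the open unit disc around t: |1 - t d|^2
    = 1 - 2 Re (t d) + |d|^2 >= |d|^2. *)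
Lemma hexagon_inv_dist (d : C) (s t : Z) :
  hexagon d -> d <> 0 -> eis_norm s t = 1%Z -> (1 <= Cmod (/ d - eis s t))%R.
Proof.
  intros Hd H0 Hv.
  assert (Hpos := proj1 (Cmod_gt_0 d) H0).
  replace (/ d - eis s t) with ((1 - eis s t * d) / d) by (now field).
  rewrite Cmod_div by exact H0.
  apply (Rmult_le_reg_r (Cmod d)); [exact Hpos|].
  unfold Rdiv; rewrite Rmult_assoc, Rinv_l, Rmult_1_l, Rmult_1_r by lra.
  apply Rsqr_incr_0_var; [|apply Cmod_ge_0].
  rewrite !Rsqr_pow2.
  specialize (Hd s t Hv).
  assert (M : (Cmod (eis s t * d) ^ 2 = Cmod d ^ 2)%R)
    by (rewrite Cmod_mult, Cmod_eis_unit by exact Hv; ring).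
  rewrite (Cmod2_alt (1 - _)); rewrite (Cmod2_alt (_ * _)) in M.
  unfold Cminus; rewrite re_plus, im_plus, re_opp, im_opp, re_RtoC, im_RtoC.
  nra.
Qed.

Lemma digit_norm_ge3 (d : C) (x y : Z) :
  hexagon d -> d <> 0 -> hexagon (/ d - eis x y) -> (3 <= eis_norm x y)%Z.
Proof.
  intros Hd H0 Hw.
  destruct (Z_le_gt_dec 3 (eis_norm x y)) as [|Hlt]; [assumption|exfalso].
  assert (Hw1 := hexagon_Cmod_lt1 _ Hw).
  (* Norm 2 is not represented. A unit is too far from [/ d], and so is 0 because |d| < 1. *)
  assert (H01 : eis_norm x y = 1%Z \/ (x = 0 /\ y = 0)%Z).
  { destruct (eis_norm_bound x y) as [Hx Hy]; [lia|].
    clear Hw Hw1; revert Hlt; eis_enum x; eis_enum y; cbn; lia. }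
  destruct H01 as [H1 | [-> ->]].
  - pose proof (hexagon_inv_dist d x y Hd H0 H1); lra.
  - replace (/ d - eis 0 0) with (/ d) in Hw1 by (unfold eis; ring).
    rewrite Cmod_inv in Hw1 by exact H0.
    assert (Hpos := proj1 (Cmod_gt_0 d) H0).
    pose proof (hexagon_Cmod_lt1 _ Hd).
    pose proof (Rinv_lt_contravar (Cmod d) 1); rewrite Rinv_1 in *; nra.
Qed.

(* A circle of radius 1 around a unit [a - t] that passes through the digit [a]
   is mapped by [z |-> / (z - a)] to the line [Re (t z) = - 1 / 2]. *)
Lemma digit_succ_trace (d : C) (x y x' y' s t : Z) :
  let w := / d - eis x y in
  hexagon d -> d <> 0 -> w <> 0 -> hexagon (/ w - eis x' y') ->
  eis_norm s t = 1%Z -> eis_norm (x - s) (y - t) = 1%Z ->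
  (-2 <= eis_trace_mul s t x' y')%Z.
Proof.
  intros w Hd H0 Hw0 Hw' Ht Hv.
  pose proof (hexagon_inv_dist d _ _ Hd H0 Hv) as H.
  rewrite eis_sub in H.
  replace (/ d - (eis x y - eis s t)) with (w + eis s t) in H
    by (unfold w; ring).
  specialize (Hw' s t Ht).
  replace (eis s t * (/ w - eis x' y'))
    with (eis s t * / w - eis s t * eis x' y') in Hw' by ring.
  unfold Cminus in Hw'; rewrite re_plus, re_opp, Re_eis_mul in Hw'.
  (* Expanding |w + t|^2 >= 1 gives |w|^2 + 2 Re (t conj w) >= 0; divide by |w|^2. The hexagon bound
     on the next remainder costs another 1/2. *)
  assert (Hinv : (- (1 / 2) <= Re (eis s t * / w))%R).
  { pose proof (Cmod_eis_sqr s t) as HN; rewrite Ht, Cmod2_alt in HN.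
    assert (Hpos := proj1 (Cmod_gt_0 w) Hw0).
    assert (Hsq : (0 < Re w ^ 2 + Im w ^ 2)%R)
      by (rewrite <- Cmod2_alt; nra).
    apply (fun H => pow_incr _ _ 2 (conj Rle_0_1 H)) in H.
    rewrite Cmod2_alt, re_plus, im_plus in H.
    rewrite re_mult.
    replace (Re (/ w)) with (Re w / (Re w ^ 2 + Im w ^ 2))%R by reflexivity.
    replace (Im (/ w)) with (- Im w / (Re w ^ 2 + Im w ^ 2))%R by reflexivity.
    apply (Rmult_le_reg_r (Re w ^ 2 + Im w ^ 2)); [exact Hsq|].
    field_simplify; [nra|lra]. }
  apply le_IZR; lra.
Qed.

(** * Growth of the denominators over one step *)

Lemma Cmod_add_ge (u v : C) : (Cmod u - Cmod v <= Cmod (u + v))%R.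
Proof.
  pose proof (Cmod_triangle (u + v) (- v)) as H.
  replace (u + v + - v) with u in H by ring.
  rewrite Cmod_opp in H; lra.
Qed.

Lemma Cmod_mul_add_ge (a u v : C) :
  (Cmod a * Cmod u - Cmod v <= Cmod (a * u + v))%R.
Proof. rewrite <- Cmod_mult; apply Cmod_add_ge. Qed.

(* Expresses [|b q + v| > |q|] as [q] avoiding a disc. *)
Lemma Cmod_mul_add_sqr_norm3 (b q v : C) :
  (Cmod b ^ 2 = 3 ->
   Cmod (b * q + v) ^ 2 - Cmod q ^ 2 =
   2 * Cmod (q + Cconj b / 2 * v) ^ 2 - Cmod v ^ 2 / 2)%R.
Proof.
  intros Hb; rewrite !Cmod2_alt in *.
  destruct b as [b1 b2], q as [q1 q2], v as [v1 v2]; cbn in *.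
  match goal with |- (?L = ?M)%R =>
    enough (E : (L - M = (b1 ^ 2 + b2 ^ 2 - 3) *
                         (q1 ^ 2 + q2 ^ 2 - (v1 ^ 2 + v2 ^ 2) / 2))%R) end.
  { cbn in E; rewrite Hb in E; lra. }
  field.
Qed.

Lemma Cmod_add_half_conj_sqr (a b : C) :
  (Cmod (a + Cconj b / 2) ^ 2 = Cmod a ^ 2 + Re (a * b) + Cmod b ^ 2 / 4)%R.
Proof. rewrite !Cmod2_alt; destruct a, b; cbn; field. Qed.

Section Step.
(** [u], [v], [q], [r] stand for q_(n-2), ..., q_(n+1), and [a], [b] for the digits a_n, a_(n+1). *)
Variables (x y x' y' : Z) (u v : C).
Let a := eis x y.
Let b := eis x' y'.
Let q := a * v + u.
Let r := b * q + v.
Hypothesis Ha : (3 <= eis_norm x y)%Z.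
Hypothesis Hb : (3 <= eis_norm x' y')%Z.
Hypothesis Hab : forall s t : Z,
  eis_norm s t = 1%Z -> eis_norm (x - s) (y - t) = 1%Z ->
  (-2 <= eis_trace_mul s t x' y')%Z.
Hypothesis Huv : (Cmod u < Cmod v)%R.
Hypothesis Hvq : (Cmod v < Cmod q)%R.

Lemma step_skip : (3 / 2 * Cmod v < Cmod r)%R.
Proof.
  pose proof (Cmod_eis_sqr x y : (Cmod a ^ 2 = _)%R) as EA.
  pose proof (Cmod_eis_sqr x' y' : (Cmod b ^ 2 = _)%R) as EB.
  pose proof (Cmod_ge_0 a) as A0; pose proof (Cmod_ge_0 b) as B0.
  pose proof (Cmod_ge_0 u) as U0.
  pose proof (Cmod_mul_add_ge a v u : (_ <= Cmod q)%R) as Hq.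
  pose proof (Cmod_mul_add_ge b q v : (_ <= Cmod r)%R) as Hr.
  pose proof (IZR_le _ _ Hb) as Hb3.
  destruct (eis_norm_gap _ _ Hb) as [Nb | [Nb | Nb]];
    (* Here |r| >= 5/2 |q| - |v| > 3/2 |v|. *)
    [| | apply IZR_le in Nb; assert (5 / 2 <= Cmod b)%R by nra; nra];
    (destruct (eis_norm_gap _ _ Ha) as [Na | [Na | Na]];
     (* The constants lie just below sqrt 7 and sqrt 3; 1.7 * 1.64 - 1 exceeds 3/2. *)
     [| | apply IZR_le in Na;
          assert (264 / 100 <= Cmod a)%R by nra;
          assert (17 / 10 <= Cmod b)%R by nra;
          assert (164 / 100 * Cmod v <= Cmod q)%R by nra; nra]).
  all: pose proof (eis_mul_add1_norm_ge x y x' y' ltac:(lia) ltac:(lia) Hab) as H.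
  all: apply IZR_le in H; rewrite <- Cmod_eis_mul_add1_sqr in H.
  all: fold a b in H; pose proof (Cmod_ge_0 (a * b + 1)) as C0.
  all: pose proof (Cmod_mul_add_ge (a * b + 1) v (b * u)) as Hr'.
  all: replace ((a * b + 1) * v + b * u) with r in Hr' by (unfold r, q; ring).
  all: rewrite Cmod_mult in Hr'.
  all: rewrite Nb in EB, H; cbn in H.
  (* As |b| <= 2, (|b| + 3/2)^2 <= |b|^2 + 33/4 < |b|^2 + 9. *)
  all: assert (Cmod b + 3 / 2 <= Cmod (a * b + 1))%R
         by (assert (Cmod b <= 2)%R by nra; nra).
  all: assert (1 <= Cmod b)%R by nra; nra.
Qed.

(** Since q + (conj b / 2) v = (a + conj b / 2) v + u and |u| < |v|, the bound 3/2 keeps [q] out of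
    the disc of radius |v|/2 around -(conj b / 2) v. *)
Lemma digit_add_half_conj :
  eis_norm x' y' = 3%Z -> (3 / 2 <= Cmod (a + Cconj b / 2))%R.
Proof.
  intros Nb.
  pose proof (Cmod_eis_sqr x y : (Cmod a ^ 2 = _)%R) as EA.
  pose proof (Cmod_eis_sqr x' y' : (Cmod b ^ 2 = _)%R) as EB.
  pose proof (Cmod_ge_0 a) as A0; pose proof (Cmod_ge_0 b) as B0.
  pose proof (Re_eis_mul x y x' y' : (Re (a * b) = _)%R) as ET.
  rewrite Nb in EB.
  destruct (Z_le_gt_dec 7 (eis_norm x y)) as [Na | Na].
  - apply IZR_le in Na.
    pose proof (Cmod_add_ge a (Cconj b / 2)) as H.
    rewrite Cmod_div, Cmod_conj, Cmod_R, Rabs_pos_eq in H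
      by (lra || (intros E; apply RtoC_inj in E; lra)).
    assert (264 / 100 <= Cmod a)%R by nra.
    assert (Cmod b <= 2)%R by nra; nra.
  - pose proof (eis_norm_gap _ _ Ha) as Na'.
    pose proof (eis_mul_add1_norm_ge x y x' y' ltac:(lia) ltac:(lia) Hab) as H.
    (* The pair bound reads 3 N(a) + tr(ab) >= 11 with N(a) <= 4; the value 3 is what |a + conj b /
       2|^2 >= 9/4 requires. *)
    assert (HT : (3 <= 2 * eis_norm x y + eis_trace_mul x y x' y')%Z) by nia.
    apply IZR_le in HT; rewrite plus_IZR, mult_IZR, <- EA in HT.
    pose proof (Cmod_add_half_conj_sqr a b) as E.
    pose proof (Cmod_ge_0 (a + Cconj b / 2)).
    rewrite ET, EB in E; nra.
Qed.

(** If |b| >= 2, then 2|q| - |v| > |q| suffices. For |b| = sqrt 3 the triangle inequality is too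
    weak, and the excluded disc is used. *)
Lemma step_grow : (Cmod q < Cmod r)%R.
Proof.
  pose proof (Cmod_eis_sqr x' y' : (Cmod b ^ 2 = _)%R) as EB.
  pose proof (Cmod_ge_0 b) as B0; pose proof (Cmod_ge_0 u) as U0.
  pose proof (Cmod_mul_add_ge b q v : (_ <= Cmod r)%R) as Hr.
  destruct (Z.eq_dec (eis_norm x' y') 3) as [Nb | Nb].
  - rewrite Nb in EB.
    pose proof (Cmod_mul_add_sqr_norm3 b q v EB) as E; fold r in E.
    pose proof (digit_add_half_conj Nb) as H.
    pose proof (Cmod_mul_add_ge (a + Cconj b / 2) v u) as H'.
    replace ((a + Cconj b / 2) * v + u) with (q + Cconj b / 2 * v) in H'
      by (unfold q; ring).
    assert (Cmod v / 2 < Cmod (q + Cconj b / 2 * v))%R by nra.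
    pose proof (Cmod_ge_0 r); nra.
  - assert (Nb4 : (4 <= eis_norm x' y')%Z) by lia.
    apply IZR_le in Nb4.
    assert (2 <= Cmod b)%R by nra; nra.
Qed.

End Step.

(** * Subfields and the field generated by [omega] *)

Lemma Q_adjoin_subfield (w : C) : is_subfield (Q_adjoin w).
Proof.
  split.
  - intros S HS _; apply (subfield_one S HS).
  - intros u v Hu Hv S HS Hw; apply (subfield_sub S HS); [apply Hu | apply Hv]; assumption.
  - intros u v Hu Hv S HS Hw; apply (subfield_mul S HS); [apply Hu | apply Hv]; assumption.
  - intros u Hu H0 S HS Hw; apply (subfield_inv S HS); [apply Hu |]; assumption.
Qed.

Section Subfield.
Variables (S : C -> Prop) (HS : is_subfield S).

Lemma subfield_zero : S 0.
Proof.
  replace (RtoC 0) with (1 - 1) by ring.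
  apply (subfield_sub S HS); apply (subfield_one S HS).
Qed.

Lemma subfield_add (u v : C) : S u -> S v -> S (u + v).
Proof.
  intros Hu Hv; replace (u + v) with (u - (0 - v)) by ring.
  apply (subfield_sub S HS); [assumption|].
  apply (subfield_sub S HS); [apply subfield_zero | assumption].
Qed.

Lemma subfield_IZR (k : Z) : S (RtoC (IZR k)).
Proof.
  revert k; apply Z.peano_ind.
  - apply subfield_zero.
  - intros k IH; rewrite succ_IZR, RtoC_plus.
    apply subfield_add; [exact IH | apply (subfield_one S HS)].
  - intros k IH; unfold Z.pred; rewrite plus_IZR, RtoC_plus.
    replace (RtoC (IZR (-1))) with (- (RtoC 1)) by (now rewrite <- RtoC_opp).
    apply (subfield_sub S HS); [exact IH | apply (subfield_one S HS)].
Qed.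

Lemma subfield_Eisenstein (u : C) : S omega -> Eisenstein u -> S u.
Proof.
  intros Hw [x [y ->]].
  apply subfield_add; [apply subfield_IZR|].
  apply (subfield_mul S HS); [apply subfield_IZR | assumption].
Qed.
End Subfield.

(** * The expansion of z and its denominators *)

Section Expansion.
Variables (f : C -> C) (Hf : nearest_integer_algorithm f).
Variables (z : C) (Hz : ~ Q_adjoin omega z).

Lemma partial_quot_Eisenstein (n : nat) : Eisenstein (partial_quot f z n).
Proof. apply Hf. Qed.

(** Membership would pass back from z_(n+1) to z_n = 1 / z_(n+1) + a_n. Hence no remainder vanishes,
    and [iter_z] never inverts 0. *)
Lemma iter_z_notin (n : nat) : ~ Q_adjoin omega (iter_z f z n).
Proof.
  assert (HK := Q_adjoin_subfield omega).
  assert (HE : forall u, Eisenstein u -> Q_adjoin omega u)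
    by (intros u; apply subfield_Eisenstein; [assumption | now intros S]).
  induction n as [|n IH]; [exact Hz|]; cbn; intros H; apply IH.
  set (w := iter_z f z n) in *.
  assert (Hfw : Q_adjoin omega (f w)) by (apply HE, Hf).
  assert (H0 : w - f w <> 0).
  { intros E; apply IH; replace w with (w - f w + f w) by ring.
    rewrite E, Cplus_0_l; exact Hfw. }
  assert (Hi : / (w - f w) <> 0).
  { apply Cmod_gt_0; rewrite Cmod_inv by exact H0.
    apply Rinv_0_lt_compat, Cmod_gt_0, H0. }
  replace w with (/ / (w - f w) + f w) by (field; auto).
  apply (subfield_add _ HK); [apply (subfield_inv _ HK)|]; assumption.
Qed.

Let d (n : nat) : C := iter_z f z n - partial_quot f z n.

Lemma remainder_hexagon (n : nat) : hexagon (d n).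
Proof. apply nearest_hexagon, Hf. Qed.

Lemma remainder_neq0 (n : nat) : d n <> 0.
Proof.
  intros E; apply (iter_z_notin n).
  replace (iter_z f z n) with (d n + partial_quot f z n) by (unfold d; ring).
  rewrite E, Cplus_0_l.
  apply subfield_Eisenstein; [apply Q_adjoin_subfield | now intros S |].
  apply partial_quot_Eisenstein.
Qed.

Lemma remainder_succ (n : nat) : d (S n) = / d n - partial_quot f z (S n).
Proof. reflexivity. Qed.

Lemma partial_quot_norm_ge3 (n : nat) (x y : Z) :
  partial_quot f z (S n) = eis x y -> (3 <= eis_norm x y)%Z.
Proof.
  intros E; apply (digit_norm_ge3 (d n));
    [apply remainder_hexagon | apply remainder_neq0 |].
  rewrite <- E, <- remainder_succ; apply remainder_hexagon.
Qed.

Let Q (n : nat) : C * C := Q_rec (partial_quot f z) 0 1 n.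

Lemma Q_rec_S (n : nat) :
  Q (S n) = (snd (Q n), partial_quot f z (S n) * snd (Q n) + fst (Q n)).
Proof. unfold Q; cbn; now destruct (Q_rec _ _ _ n). Qed.

(** Supplies [Ha], [Hb], [Hab] of the step lemmas. Indices start at 1 because a_0 is not the digit
    of an inverted remainder. *)
Lemma partial_quot_pair (n : nat) : exists x y x' y' : Z,
  partial_quot f z (S n) = eis x y /\ partial_quot f z (S (S n)) = eis x' y' /\
  (3 <= eis_norm x y)%Z /\ (3 <= eis_norm x' y')%Z /\
  forall s t : Z, eis_norm s t = 1%Z -> eis_norm (x - s) (y - t) = 1%Z ->
    (-2 <= eis_trace_mul s t x' y')%Z.
Proof.
  destruct (partial_quot_Eisenstein (S n)) as [x [y E]].
  destruct (partial_quot_Eisenstein (S (S n))) as [x' [y' E']].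
  fold (eis x y) in E; fold (eis x' y') in E'.
  exists x, y, x', y'; repeat split; [exact E | exact E' | | |].
  - exact (partial_quot_norm_ge3 n x y E).
  - exact (partial_quot_norm_ge3 (S n) x' y' E').
  - intros s t; apply (digit_succ_trace (d n)); rewrite <- ?E, <- ?E'.
    + apply remainder_hexagon.
    + apply remainder_neq0.
    + rewrite <- remainder_succ; apply remainder_neq0.
    + rewrite <- !remainder_succ; apply remainder_hexagon.
Qed.

(** Both inequalities are carried along, since [step_grow] needs two successive ones. *)
Lemma Q_rec_grow (n : nat) :
  (Cmod (fst (Q n)) < Cmod (snd (Q n)))%R /\
  (Cmod (snd (Q n)) < Cmod (snd (Q (S n))))%R.
Proof.
  induction n as [|n [IH1 IH2]].
  (* Here q_(-1) = 0, q_0 = 1 and q_1 = a_1, with |a_1|^2 >= 3. *)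
  - cbn; rewrite Cmod_0, Cmod_1; split; [lra|].
    destruct (partial_quot_Eisenstein 1) as [x [y E]]; fold (eis x y) in E.
    assert (H := IZR_le _ _ (partial_quot_norm_ge3 0 x y E)).
    rewrite <- Cmod_eis_sqr, <- E in H.
    replace (partial_quot f z 1 * 1 + 0) with (partial_quot f z 1) by ring.
    pose proof (Cmod_ge_0 (partial_quot f z 1)); nra.
  - split; [now rewrite Q_rec_S at 1|].
    destruct (partial_quot_pair n) as (x & y & x' & y' & E & E' & Ha & Hb & Hab).
    rewrite (Q_rec_S (S n)), Q_rec_S in *; cbn [fst snd] in *.
    rewrite E, E' in *; now apply step_grow.
Qed.

Lemma Q_rec_skip (n : nat) :
  (3 / 2 * Cmod (snd (Q n)) < Cmod (snd (Q (S (S n)))))%R.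
Proof.
  destruct (Q_rec_grow n) as [H1 H2].
  destruct (partial_quot_pair n) as (x & y & x' & y' & E & E' & Ha & Hb & Hab).
  rewrite (Q_rec_S (S n)), Q_rec_S in *; cbn [fst snd] in *.
  rewrite E, E' in *; now apply step_skip.
Qed.

End Expansion.

Theorem theorem6p1 (f : C -> C) (Hf : nearest_integer_algorithm f)
    (z : C) (Hz : ~ Q_adjoin omega z) (n : nat) (Hn : (1 <= n)%nat) :
  (Cmod (Q_pair_q (partial_quot f z) (n + 1) /
         Q_pair_q (partial_quot f z) (n - 1)) > 3 / 2)%R.
Proof.
  destruct n as [|n]; [lia|].
  replace (S n + 1)%nat with (S (S n)) by lia.
  replace (S n - 1)%nat with n by lia.
  unfold Q_pair_q.
  destruct (Q_rec_grow f Hf z Hz n) as [H _].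
  pose proof (Q_rec_skip f Hf z Hz n) as Hskip.
  set (u := snd (Q_rec _ 0 1 n)) in *.
  (* Strict growth makes the denominator of the quotient nonzero. *)
  assert (Hu : (0 < Cmod u)%R)
    by (eapply Rle_lt_trans; [apply Cmod_ge_0 | exact H]).
  rewrite Cmod_div by (now apply Cmod_gt_0).
  exact (proj1 (Rlt_div_r _ _ _ Hu) Hskip).
Qed.
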